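(* Let $G$ be a graph and $\theta$ a real number, and let $Q_1,\dots,Q_m$ be the components of $G\setminus A_\theta(G)$ with $\mathrm{mult}(\theta,Q_j)=0$. For distinct vertices $u,v$, $\mathrm{mult}(\theta,S_\theta(G)\setminus\{u,v\})=\mathrm{mult}(\theta,S_\theta(G))+2$ if and only if one of the following holds: (a) $u,v\in A_\theta(G)$; (b) one of $u,v$ lies in $A_\theta(G)$ and the other in $P_\theta(G)$; (c) $u,v\in P_\theta(G)$ with $u\in V(Q_{j_1})$, $v\in V(Q_{j_2})$ for some $j_1\neq j_2$; (d) $u,v\in V(Q_{j_0})$ for some $j_0$ and $\mathrm{mult}(\theta,Q_{j_0}\setminus\{u,v\})=2$.
   Context: All graphs are finite and simple. For a graph $G$ on $n$ vertices, let $p(G,r)$ be the number of $r$-matchings of $G$ ($p(G,0)=1$); the matching polynomial is $\mu(G,x)=\sum_{r=0}^{\lfloor n/2\rfloor}(-1)^r p(G,r)x^{n-2r}$. For real $\theta$, $\mathrm{mult}(\theta,G)$ is the multiplicity of $\theta$ as a root of $\mu(G,x)$ (it is $0$ if $\theta$ is not a root). $G\setminus X$ denotes deletion of the vertex set $X$; $G\setminus u=G\setminus\{u\}$. A vertex $u$ is $\theta$-essential, $\theta$-neutral, or $\theta$-positive in $G$ according as $\mathrm{mult}(\theta,G\setminus u)$ equals $\mathrm{mult}(\theta,G)-1$, $\mathrm{mult}(\theta,G)$, or $\mathrm{mult}(\theta,G)+1$. A vertex is $\theta$-special if it is not $\theta$-essential but is adjacent to a $\theta$-essential vertex. $A_\theta(G)$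 is the set of $\theta$-special vertices and $P_\theta(G)$ the set of $\theta$-positive vertices that are not $\theta$-special. A connected graph is $\theta$-critical if all its vertices are $\theta$-essential in it; every component of $G\setminus A_\theta(G)$ is either $\theta$-critical or has $\mathrm{mult}(\theta,\cdot)=0$. $S_\theta(G)$ is the graph on $V(G)$ whose edges are the edges of $G$ together with all pairs $\{w,z\}$, $z\neq w$, with $w\in A_\theta(G)$. *)

(* Defs.v *)
(* Graphs: vertex type T : finType, adjacency e : rel T
   (assumed symmetric & irreflexive in the theorem). Subgraphs used in the
   statement are induced subgraphs, given by a vertex set S : {set T}. *)
From HB Require Import structures.
From mathcomp Require Import all_boot all_order all_algebra.
Set Implicit Arguments. Unset Strict Implicit. Unset Printing Implicit Defensive.
Import Order.TTheory GRing.Theory Num.Theory.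
Local Open Scope ring_scope.

Section Matching.
Variables (T : finType) (e : rel T).

Definition is_matching (S : {set T}) (M : {set {set T}}) : bool :=
  [forall E in M, exists x, exists y,
     [&& x \in S, y \in S, e x y & E == [set x; y]]] &&
  [forall E in M, forall F in M, (E != F) ==> [disjoint E & F]].

Definition nmatch (S : {set T}) (r : nat) : nat :=
  #|[set M : {set {set T}} | is_matching S M & #|M| == r]|.

Definition match_poly (R : nzRingType) (S : {set T}) : {poly R} :=
  \sum_(r < (#|S|./2).+1)
     ((-1) ^+ r * (nmatch S r)%:R) *: 'X^(#|S| - r.*2).

Definition mult (R : fieldType) (theta : R) (S : {set T}) : nat :=
  mup theta (match_poly R S).

Definition essential (R : fieldType) (theta : R) (u : T) : bool :=
  (mult theta [set~ u]).+1 == mult theta [set: T].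
Definition positive (R : fieldType) (theta : R) (u : T) : bool :=
  mult theta [set~ u] == (mult theta [set: T]).+1.
Definition special (R : fieldType) (theta : R) (u : T) : bool :=
  ~~ essential theta u && [exists w, e u w && essential theta w].

Definition Aset (R : fieldType) (theta : R) : {set T} :=
  [set u | special theta u].
Definition Pset (R : fieldType) (theta : R) : {set T} :=
  [set u | positive theta u && ~~ special theta u].

Definition rel_on (S : {set T}) : rel T :=
  [rel x y | [&& x \in S, y \in S & e x y]].
Definition comp (S : {set T}) (x : T) : {set T} :=
  [set y | connect (rel_on S) x y].
Definition is_comp (S : {set T}) (C : {set T}) : Prop :=
  exists2 x, x \in S & C = comp S x.

End Matching.

Definition Srel (T : finType) (e : rel T) (R : fieldType) (theta : R) : rel T :=
  [rel w z | e w z || ((w != z) && ((w \in Aset e theta) || (z \in Aset e theta)))].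

(* Main.v *)
Require Import Defs.
From HB Require Import structures.
From mathcomp Require Import all_boot all_order all_algebra.
From mathcomp Require Import ring zify.
Import Order.TTheory GRing.Theory Num.Theory.
Local Open Scope ring_scope.

(** Write [mu S] for the matching polynomial of the subgraph induced by [S] and
    [m S] for its order at [theta].  Expanding at a vertex shows that
    [mu (S\u) mu (S\v) - mu S mu (S\uv)] is a sum of squares of matching
    polynomials of subgraphs (Heilmann-Lieb), so it has even order and a
    positive leading coefficient at [theta].  Together with
    [mu' S = sum_v mu (S\v)] this yields interlacing, parity constraints on [m],
    and the key criterion: [u] is positive in [S] iff some neighbour of [u] is
    essential in [S\u].

    Stability: deleting a special vertex [u] preserves the type of every other
    vertex.  It is proved by induction on [S], simultaneously with the
    transitivity of "deleting both vertices lowers [m] by at most one" on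
    essential vertices.  By the criterion, special vertices remain positive when
    edges are added to them, so the graph S_theta(G) has the same multiplicity,
    vertex types and special vertices as G.

    If [m (S_theta(G)\uv)] exceeds [m (S_theta(G))] by 2 and [u], [v] are not
    special, the special vertices can be deleted one at a time, each deletion
    raising [m], because each of them is adjacent to every vertex and in
    particular to an essential one.  What remains is a multiplicity count on
    the components of G\A. *)

(** * Orders of vanishing at [t], and sums of squares near [t] *)

Section LocalOrder.
Set Implicit Arguments.
Unset Strict Implicit.
Variables (R : realFieldType) (t : R).
Local Notation Xt := ('X - t%:P).

Lemma XsubCX_eq0 n : (Xt ^+ n == 0) = false.
Proof. by rewrite expf_eq0 polyXsubC_eq0 andbF. Qed.

Lemma horner_XsubCX n : (Xt ^+ n).[t] = (n == 0%N)%:R.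
Proof. by rewrite horner_exp hornerXsubC subrr expr0n. Qed.

Lemma mup_XsubCX_mul n (q : {poly R}) : q.[t] != 0 -> mup t (Xt ^+ n * q) = n.
Proof. by move=> qt; rewrite mupMl ?mup_XsubCX ?eqxx. Qed.

Lemma mup_dvdP n (p : {poly R}) : p != 0 -> (n <= mup t p)%N ->
  exists q, p = Xt ^+ n * q.
Proof.
move=> p0; rewrite mup_geq // => /dvdpP[q ->].
by exists q; rewrite mulrC.
Qed.

Lemma mup_ge n (p q : {poly R}) : p != 0 -> p = Xt ^+ n * q -> (n <= mup t p)%N.
Proof. by move=> p0 pE; rewrite mup_geq // pE dvdp_mulIl. Qed.

Lemma mup_factor (p : {poly R}) : p != 0 ->
  exists2 q, p = Xt ^+ mup t p * q & q.[t] != 0.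
Proof.
move=> p0; have [q pE] := mup_dvdP p0 (leqnn _); exists q => //.
apply/negP => /eqP q0; have /factor_theorem[r qE] : root q t by apply/eqP.
have : (mup t p < mup t p)%N; last by rewrite ltnn.
by apply: (@mup_ge _ _ r) => //; rewrite exprS {1}pE qE; ring.
Qed.

(* The local shape at [t] of a sum of squares. *)
Definition even_pos (p : {poly R}) :=
  p = 0 \/ exists a q, p = Xt ^+ a.*2 * q /\ 0 < q.[t].

Lemma even_pos_mup p : even_pos p -> ~~ odd (mup t p) \/ p = 0.
Proof.
case=> [->|[a [q [-> q0]]]]; [by right | left].
by rewrite mup_XsubCX_mul ?gt_eqF // odd_double.
Qed.

(** Nothing is assumed on the parity of [n]: comparing orders forces it to be the even exponent
    given by [even_pos], and cancelling the power of [Xt] then identifies [q]. *)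
Lemma even_pos_lead n (p q : {poly R}) :
  even_pos p -> p = Xt ^+ n * q -> q.[t] != 0 -> 0 < q.[t].
Proof.
move=> ep pE q0; case: ep => [p0|[a [r [pE' r0]]]].
  move/eqP: p0; rewrite pE mulf_eq0 XsubCX_eq0 /= => /eqP qz.
  by rewrite qz horner0 eqxx in q0.
have an : a.*2 = n.
  by rewrite -(mup_XsubCX_mul n q0) -pE pE' mup_XsubCX_mul // gt_eqF.
move: pE; rewrite pE' an => /(mulfI (negbT (XsubCX_eq0 n))) qr.
by rewrite -qr.
Qed.

Lemma even_pos_sqr p : even_pos (p ^+ 2).
Proof.
have [->|p0] := eqVneq p 0; first by left; rewrite expr0n.
have [q pE q0] := mup_factor p0; right; exists (mup t p), (q ^+ 2).
split; last by rewrite horner_exp exprn_even_gt0.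
by rewrite {1}pE exprMn -exprM muln2.
Qed.

(** Positive leading coefficients cannot cancel, so the sum of two nonzero summands has the smaller
    of their orders. *)
Lemma even_posD_mup p q : even_pos p -> even_pos q ->
  even_pos (p + q) /\ (p != 0 -> p + q != 0 /\ (mup t (p + q) <= mup t p)%N).
Proof.
case=> [->|[a [p1 [-> p1t]]]]; first by rewrite add0r eqxx.
case=> [->|[b [q1 [-> q1t]]]].
  by rewrite addr0; split=> //; right; exists a, p1.
rewrite mup_XsubCX_mul ?gt_eqF //.
suff [c [r [-> rt ca]]] : exists c r, [/\ Xt ^+ a.*2 * p1 + Xt ^+ b.*2 * q1
    = Xt ^+ c.*2 * r, 0 < r.[t] & (c <= a)%N].
  split=> [|_]; first by right; exists c, r.
  rewrite mup_XsubCX_mul ?gt_eqF // leq_double ca mulf_eq0 XsubCX_eq0 /=.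
  by split=> //; apply: contraTneq rt => ->; rewrite horner0 ltxx.
have [ab|ba] := leqP a b.
  exists a, (p1 + Xt ^+ (b - a).*2 * q1); split=> //.
    by rewrite mulrDr mulrA -exprD -doubleD subnKC.
  by rewrite hornerD hornerM horner_XsubCX ltr_wpDr // mulr_ge0 ?ler0n ?ltW.
exists b, (Xt ^+ (a - b).*2 * p1 + q1); split=> //; last exact: ltnW.
  by rewrite mulrDr mulrA -exprD -doubleD subnKC // ltnW.
by rewrite hornerD hornerM horner_XsubCX ltr_wpDl // mulr_ge0 ?ler0n ?ltW.
Qed.

Lemma even_posD p q : even_pos p -> even_pos q -> even_pos (p + q).
Proof. by move=> ep eq; case: (even_posD_mup ep eq). Qed.

Lemma even_pos_sum (I : finType) (P : pred I) (F : I -> {poly R}) :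
  (forall i, P i -> even_pos (F i)) -> even_pos (\sum_(i | P i) F i).
Proof. by move=> eF; apply: big_ind => //; [left | apply: even_posD]. Qed.

Lemma mup_even_posD p q : even_pos p -> even_pos q -> p != 0 ->
  p + q != 0 /\ (mup t (p + q) <= mup t p)%N.
Proof. by move=> ep eq; case: (even_posD_mup ep eq). Qed.

Lemma deriv_XsubCX_mul n (q : {poly R}) :
  (Xt ^+ n.+1 * q)^`() = Xt ^+ n * (n.+1%:R *: q + Xt * q^`()).
Proof.
rewrite derivM deriv_exp derivXsubC mul1r /= -mulr_natr exprS -mul_polyC.
by rewrite rmorph_nat; ring.
Qed.

(** The truncated [n.-1] makes the case [n = 0] harmless: no vanishing is claimed there. *)
Lemma deriv_mup n (p : {poly R}) : p != 0 -> (n <= mup t p)%N ->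
  exists q, p^`() = Xt ^+ n.-1 * q.
Proof.
case: n => [|n] p0 np; first by exists p^`(); rewrite mul1r.
by have [q ->] := mup_dvdP p0 np; rewrite deriv_XsubCX_mul; eexists.
Qed.

Lemma mupB_ge n (p q : {poly R}) : p != 0 -> q != 0 -> p - q != 0 ->
  (n <= mup t p)%N -> (n <= mup t q)%N -> (n <= mup t (p - q))%N.
Proof. by move=> p0 q0 pq0; rewrite !mup_geq // => np nq; rewrite dvdp_sub. Qed.

Lemma mupB_lt (p q : {poly R}) : p != 0 -> q != 0 -> (mup t p < mup t q)%N ->
  p - q != 0 /\ mup t (p - q) = mup t p.
Proof.
move=> p0 q0 lt_pq; have [p1 pE p1t] := mup_factor p0.
have [q1 qE] := mup_dvdP q0 lt_pq.
have pqE : p - q = Xt ^+ mup t p * (p1 - Xt * q1).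
  by rewrite {1}pE {1}qE exprS; ring.
have r0 : (p1 - Xt * q1).[t] != 0.
  by rewrite hornerD hornerN hornerM hornerXsubC subrr mul0r subr0.
rewrite pqE mup_XsubCX_mul // mulf_eq0 XsubCX_eq0 /=; split=> //.
by apply: contraNneq r0 => ->; rewrite horner0.
Qed.

End LocalOrder.

(** * Matchings and the vertex expansion of the matching polynomial *)

Section MatchingPolynomial.
Set Implicit Arguments.
Unset Strict Implicit.
Variables (T : finType) (e : rel T).
Hypotheses (e_sym : symmetric e) (e_irr : irreflexive e).
Implicit Types (S E F : {set T}) (M : {set {set T}}).

Definition is_edge E := [exists x, exists y, e x y && (E == [set x; y])].

Lemma is_matchingP S M : reflect
  ((forall E, E \in M -> E \subset S /\ is_edge E) /\
   (forall E F, E \in M -> F \in M -> E != F -> [disjoint E & F]))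
  (is_matching e S M).
Proof.
apply: (iffP andP) => -[edgeM disjM]; split.
- move=> E EM; have /existsP[x /existsP[y]] := forall_inP edgeM E EM.
  case/and4P=> xS yS exy /eqP->; split; first by rewrite subUset !sub1set xS.
  by apply/existsP; exists x; apply/existsP; exists y; rewrite exy eqxx.
- move=> E F EM FM EF.
  by have /forall_inP/(_ F FM)/implyP/(_ EF) := forall_inP disjM E EM.
- apply/forall_inP => E /edgeM[ES /existsP[x /existsP[y /andP[exy /eqP EE]]]].
  apply/existsP; exists x; apply/existsP; exists y; rewrite exy -EE eqxx !andbT.
  by rewrite EE subUset !sub1set in ES; case/andP: ES => -> ->.
- apply/forall_inP => E EM; apply/forall_inP => F FM; apply/implyP.
  exact: disjM.
Qed.

Lemma card_is_edge E : is_edge E -> #|E| = 2.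
Proof.
case/existsP=> x /existsP[y /andP[exy /eqP->]]; rewrite cards2.
by case: eqVneq exy => // ->; rewrite e_irr.
Qed.

Lemma card_matching S M : is_matching e S M -> (#|M|.*2 <= #|S|)%N.
Proof.
move=> /is_matchingP[edgeM disjM].
have coverS : cover M \subset S by apply/bigcupsP => E /edgeM[].
apply: leq_trans (subset_leq_card coverS).
rewrite (@card_uniform_partition _ 2 M (cover M)) ?muln2 //.
  by move=> E /edgeM[_ /card_is_edge].
apply/and3P; split=> //; first exact/trivIsetP.
by apply/negP => /edgeM[_ /card_is_edge]; rewrite cards0.
Qed.

Lemma match_polyE (R : nzRingType) S : match_poly e R S =
  \sum_(M | is_matching e S M) (-1) ^+ #|M| *: 'X^(#|S| - #|M|.*2).
Proof.
(* A matching has at most [#|S|./2] edges, so [inord] does not alter its size. *)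
have inordM M : is_matching e S M -> (inord #|M| : 'I_(#|S|./2).+1) = #|M| :> nat.
  move=> /card_matching Mle; apply: (@inordK (#|S|./2)).
  by rewrite ltnS -[#|M|]doubleK half_leq.
rewrite (partition_big (fun M => inord #|M| : 'I_(#|S|./2).+1) predT) //=.
apply: eq_bigr => r _.
rewrite (eq_big (fun M => M \in [set M | is_matching e S M & #|M| == r])
  (fun _ => (-1) ^+ r *: 'X^(#|S| - r.*2))) => [|M|M].
- by rewrite sumr_const scalerMnl mulr_natr.
- rewrite inE; have [Mm|//] := boolP (is_matching e S M).
  by rewrite /= -val_eqE /= inordM.
- by case/andP=> Mm /eqP <-; rewrite inordM.
Qed.

Lemma match_poly0 (R : nzRingType) : match_poly e R set0 = 1.
Proof.
rewrite match_polyE (big_pred1 set0) ?cards0 ?scale1r // => M.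
apply/idP/eqP => [/card_matching|->].
  rewrite cards0; case: (set_0Vmem M) => // -[E EM].
  by rewrite (cardsD1 E) EM.
by apply/is_matchingP; split=> E; rewrite inE.
Qed.

Lemma is_matchingD1 S u M :
  is_matching e S M && (u \notin cover M) = is_matching e (S :\ u) M.
Proof.
apply/andP/is_matchingP => [[/is_matchingP[edgeM disjM] uM]|[edgeM disjM]].
  split=> // E EM; have [ES Ee] := edgeM E EM; split=> //.
  rewrite subsetD1 ES /=; apply: contra uM => uE.
  by apply/bigcupP; exists E.
split; last first.
  by apply/bigcupP => -[E /edgeM[/subsetD1P[_ /negP uE] _] /uE].
apply/is_matchingP; split=> // E /edgeM[/subsetD1P[ES _] Ee].
by split.
Qed.

Lemma is_matchingU1 S u w M : u \in S -> w \in S -> e u w ->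
  is_matching e S ([set u; w] |: M) && ([set u; w] \notin M) =
  is_matching e (S :\ u :\ w) M.
Proof.
move=> uS wS euw; apply/andP/is_matchingP=> [[]|[edgeM disjM]].
  move=> /is_matchingP[edgeM disjM] EM; split=> [F FM|F1 F2 F1M F2M]; last first.
    by apply: disjM; rewrite inE ?F1M ?F2M orbT.
  have [|FS Fe] := edgeM F; first by rewrite inE FM orbT.
  split=> //; rewrite !subsetD1 FS /=.
  have : [disjoint [set u; w] & F].
    apply: disjM; rewrite ?inE ?eqxx ?FM ?orbT //.
    by apply: contraNneq EM => ->.
  by rewrite disjoints_subset subUset !sub1set !inE.
have uwF F : F \in M -> [disjoint [set u; w] & F].
  move=> /edgeM[]; rewrite !subsetD1 => /andP[/andP[_ uF] wF] _.
  by rewrite disjoints_subset subUset !sub1set !inE uF.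
split.
  apply/is_matchingP; split=> [F|F1 F2].
    case/setU1P=> [->|/edgeM[FS Fe]]; last first.
      split=> //; apply: subset_trans FS _.
      exact: subset_trans (subD1set _ _) (subD1set _ _).
    rewrite subUset !sub1set uS wS; split=> //.
    by apply/existsP; exists u; apply/existsP; exists w; rewrite euw eqxx.
  case/setU1P=> [->|F1M]; case/setU1P=> [->|F2M]; rewrite ?eqxx //.
  - by rewrite uwF.
  - by rewrite disjoint_sym uwF.
  - exact: disjM.
by apply/negP => /uwF; rewrite disjoints_subset subUset !sub1set !inE eqxx.
Qed.

Lemma pair2_inj (u w z : T) : w != u -> [set u; w] = [set u; z] -> w = z.
Proof. by move=> wu /setP/(_ w); rewrite !inE eqxx orbT (negPf wu) => /esym/eqP. Qed.

Lemma matching_partner S M u w z : is_matching e S M -> w != u ->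
  [set u; w] \in M -> [set u; z] \in M -> w = z.
Proof.
move=> /is_matchingP[_ disjM] wu wM zM; apply: (pair2_inj wu).
apply/eqP/negPn/negP => /(disjM _ _ wM zM).
by rewrite disjoints_subset subUset !sub1set !inE eqxx.
Qed.

Lemma covered_partner S M u : is_matching e S M ->
  (u \in cover M) = [exists w, [&& w \in S :\ u, e u w & [set u; w] \in M]].
Proof.
move=> /is_matchingP[edgeM _]; apply/bigcupP/existsP => [[E EM uE]|[w]]; last first.
  by case/and3P=> _ _ wM; exists [set u; w]; rewrite // !inE eqxx.
have [ES /existsP[x /existsP[y /andP[exy /eqP EE]]]] := edgeM E EM.
have xy : x != y by apply: contraTneq exy => ->; rewrite e_irr.
move: ES; rewrite EE subUset !sub1set => /andP[xS yS].
move: uE; rewrite EE !inE => /orP[/eqP->|/eqP->].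
  by exists y; rewrite in_setD1 eq_sym xy yS exy -EE EM.
by exists x; rewrite in_setD1 xy xS e_sym exy setUC -EE EM.
Qed.

Lemma cardsD11 S u w : u \in S -> w \in S :\ u -> #|S| = #|S :\ u :\ w|.+2.
Proof. by move=> uS wS; rewrite (cardsD1 u) uS (cardsD1 w) wS. Qed.

(** Matchings missing [u] give the first term; those covering [u] are sorted by the partner of
    [u]. *)
Lemma match_poly_rec (R : nzRingType) S u : u \in S ->
  match_poly e R S = 'X * match_poly e R (S :\ u)
    - \sum_(w in S :\ u | e u w) match_poly e R (S :\ u :\ w).
Proof.
move=> uS; rewrite !match_polyE (bigID (fun M => u \notin cover M)) /=.
congr (_ + _).
  rewrite mulr_sumr; apply: eq_big => [M|M]; first exact: is_matchingD1.
  rewrite is_matchingD1 => /card_matching Mle.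
  by rewrite -commr_polyX -scalerAl -exprSr (cardsD1 u S) uS add1n subSn.
(* [p M] is the partner of [u] in [M]; the default [u] is never reached, since only matchings
   covering [u] are summed. *)
pose p M := odflt u [pick w | [&& w \in S :\ u, e u w & [set u; w] \in M]].
rewrite (partition_big p (fun w => (w \in S :\ u) && e u w)) /=; last first.
  move=> M /andP[Mm]; rewrite negbK (covered_partner u Mm) => /existsP[w wP].
  by rewrite /p; case: pickP => [z /and3P[-> ->]|/(_ w)]; rewrite ?wP.
rewrite -sumrN; apply: eq_bigr => w /andP[wS euw].
rewrite match_polyE -sumrN.
have wS' : w \in S by case/setD1P: wS.
have wu : w != u by case/setD1P: wS.
(* Removing the edge [[set u; w]] turns the matchings that pair [u] with [w] into those of
   [S :\ u :\ w]; the lost edge accounts for the sign. *)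
rewrite (reindex_onto (fun M => [set u; w] |: M) (fun M => M :\ [set u; w])) /=.
  apply: eq_big => [M|M].
    rewrite -is_matchingU1 //.
    have -> : (([set u; w] |: M) :\ [set u; w] == M) = ([set u; w] \notin M).
      apply/eqP/idP => [<-|]; [by rewrite !inE eqxx | exact: setU1K].
    congr (_ && _); have [Mm|//] := boolP (is_matching e S _).
    rewrite negbK (covered_partner u Mm) /=.
    have wM : [set u; w] \in [set u; w] |: M by rewrite setU11.
    have -> : [exists z, [&& z \in S :\ u, e u z & [set u; z] \in [set u; w] |: M]].
      by apply/existsP; exists w; rewrite wS euw wM.
    rewrite /p; case: pickP => [z /and3P[_ _ zM]|/(_ w)]; last by rewrite wS euw wM.
    by rewrite (matching_partner Mm wu wM zM) eqxx.
  case/andP=> /andP[/andP[Mm _] _] /eqP ME.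
  have EM : [set u; w] \notin M by rewrite -ME !inE eqxx.
  rewrite cardsU1 EM exprS mulN1r scaleNr; congr (- (_ *: 'X^_)).
  by rewrite (cardsD11 uS wS) doubleS !subSS.
move=> M /andP[/andP[Mm]]; rewrite negbK (covered_partner u Mm) => ex pw.
apply: setD1K; move: pw; rewrite /p; case: pickP => [z /and3P[_ _ zM] /eqP<- //|].
by case/existsP: ex => z zP /(_ z); rewrite zP.
Qed.

End MatchingPolynomial.

(** * Deletion of single elements *)

Section SetD1.
Set Implicit Arguments.
Unset Strict Implicit.
Variable T : finType.

Lemma setD1C (S : {set T}) u v : S :\ u :\ v = S :\ v :\ u.
Proof. by rewrite !setDDl setUC. Qed.

Lemma sum_setD1_cond (V : nmodType) (A : {set T}) (P : pred T) v (F : T -> V) :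
  v \in A -> \sum_(w in A | P w) F w =
  (if P v then F v else 0) + \sum_(w in A :\ v | P w) F w.
Proof. by move=> vA; rewrite big_mkcondr (big_setD1 v) //= -big_mkcondr. Qed.

End SetD1.

(** * Product and derivative formulas *)

Section MatchingIdentities.
Set Implicit Arguments.
Unset Strict Implicit.
Variables (T : finType) (e : rel T).
Hypotheses (e_sym : symmetric e) (e_irr : irreflexive e).
Implicit Types (S A B : {set T}).

(** Only the empty matching contributes to the coefficient of degree [#|S|]. *)
Lemma match_poly_neq0 (R : nzRingType) S : match_poly e R S != 0.
Proof.
suff c1 : (match_poly e R S)`_#|S| = 1.
  by apply: contra_eq_neq c1 => ->; rewrite coef0 eq_sym oner_eq0.
have m0 : is_matching e S set0 by apply/is_matchingP; split=> E; rewrite inE.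
rewrite match_polyE // coef_sum (bigD1 set0) //= big1 => [|M].
  by rewrite cards0 subn0 coefZ coefXn eqxx mulr1 addr0.
rewrite -card_gt0 => /andP[/(card_matching e_irr) Mle M0].
have lt : (#|S| - #|M|.*2 < #|S|)%N.
  by rewrite ltn_subrL double_gt0 M0 (leq_trans _ Mle) // double_gt0.
by rewrite coefZ coefXn gtn_eqF // mulr0.
Qed.

(** Induction on [#|A|], expanding both sides at a vertex of [A]: its neighbours in the union all
    lie in [A]. *)
Lemma match_polyU (R : nzRingType) A B : [disjoint A & B] ->
  (forall x y, x \in A -> y \in B -> ~~ e x y) ->
  match_poly e R (A :|: B) = match_poly e R A * match_poly e R B.
Proof.
move En : #|A| => n; elim/ltn_ind: n A En => n IHn A En dAB nAB.
have [->|[u uA]] := set_0Vmem A; first by rewrite set0U match_poly0 // mul1r.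
have sub A' : A' \subset A :\ u ->
    match_poly e R (A' :|: B) = match_poly e R A' * match_poly e R B.
  move=> sA; have sA' := subset_trans sA (subD1set _ _).
  apply: (IHn #|A'|) => //.
  - by rewrite -En (cardsD1 u A) uA ltnS subset_leq_card.
  - exact: disjointWl dAB.
  - by move=> x y /(subsetP sA'); apply: nAB.
have uB : u \notin B by rewrite (disjointFr dAB).
have DU x : x \notin B -> (A :|: B) :\ x = (A :\ x) :|: B.
  move=> xB; rewrite setDUl; congr (_ :|: _); apply/setDidPl.
  by rewrite disjoint_sym disjoints1.
rewrite (match_poly_rec e_sym e_irr R (u := u)); last by rewrite inE uA.
rewrite (match_poly_rec e_sym e_irr R uA) mulrBl -mulrA DU // sub //.
congr (_ - _); rewrite mulr_suml; apply: eq_big => [w|w].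
  rewrite in_setU; case wB: (w \in B); rewrite ?orbF //= orbT /=.
  by rewrite (negPf (nAB _ _ uA wB)) andbF.
rewrite in_setU => /andP[wAB euw].
have wB : w \notin B by apply: contraTN euw => /(nAB _ _ uA).
rewrite (negPf wB) orbF in wAB.
have -> : (A :\ u :|: B) :\ w = (A :\ u :\ w) :|: B.
  rewrite setDUl; congr (_ :|: _); apply/setDidPl.
  by rewrite disjoint_sym disjoints1.
by rewrite sub // subD1set.
Qed.

(** Both sides are expanded at one vertex [u]; the induction hypothesis leaves double sums over [v]
    and a neighbour [w] of [u], equal after exchanging the order of summation. *)
Lemma match_poly_deriv (R : comNzRingType) S :
  (match_poly e R S)^`() = \sum_(v in S) match_poly e R (S :\ v).
Proof.
move En : #|S| => n; elim/ltn_ind: n S En => n IHn S En.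
have [->|[u uS]] := set_0Vmem S.
  by rewrite match_poly0 // big_set0 -[1]/(1%:P) derivC.
have IH1 : (match_poly e R (S :\ u))^`() =
    \sum_(v in S :\ u) match_poly e R (S :\ u :\ v).
  by apply: (IHn #|S :\ u|) => //; rewrite -En (cardsD1 u S) uS.
have IH2 w : w \in S :\ u -> (match_poly e R (S :\ u :\ w))^`() =
    \sum_(v in S :\ u :\ w) match_poly e R (S :\ u :\ w :\ v).
  move=> wS; apply: (IHn #|S :\ u :\ w|) => //.
  by rewrite -En (cardsD11 uS wS).
rewrite (match_poly_rec e_sym e_irr R uS) derivB derivM derivX mul1r IH1.
rewrite (raddf_sum (@deriv R)) [RHS](big_setD1 u) //= -addrA; congr (_ + _).
rewrite [RHS](eq_bigr (fun v => 'X * match_poly e R (S :\ u :\ v)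
   - \sum_(w in S :\ u :\ v | e u w) match_poly e R (S :\ u :\ v :\ w))); last first.
  move=> v vS; rewrite (match_poly_rec e_sym e_irr R (u := u)); last first.
    by rewrite !inE eq_sym uS andbT; case/setD1P: vS.
  by rewrite (setD1C S v u).
rewrite sumrB mulr_sumr; congr (_ - _).
rewrite (eq_bigr (fun w =>
    \sum_(v in S :\ u :\ w) match_poly e R (S :\ u :\ w :\ v)));
  last by move=> w /andP[/IH2].
rewrite (exchange_big_dep (mem (S :\ u))) /=.
  apply: eq_bigr => v vS; apply: eq_big => [w|w _]; last by rewrite setD1C.
  rewrite !in_setD1 in vS *; rewrite (andP vS).1 (andP vS).2 (eq_sym v w).
  by case: (w == v); rewrite ?andbF ?andbT.
by move=> w v _ /setD1P[].
Qed.

(** * Heilmann-Lieb identities, interlacing and the positivity criterion *)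

Section HeilmannLieb.
Variables (R : realFieldType) (t : R).
Local Notation mu := (match_poly e R).

Definition HL S u v := mu (S :\ u) * mu (S :\ v) - mu S * mu (S :\ u :\ v).

(** After expanding [mu S] and [mu (S :\ v)] at [u], the terms with factor ['X] cancel and the
    neighbour [w = v] yields the square. Unrolled, this writes [HL] as a sum of squares indexed by
    the paths from [u] to [v]. *)
Lemma HL_rec S u v : u \in S -> v \in S -> u != v ->
  HL S u v = (if e u v then mu (S :\ u :\ v) ^+ 2 else 0)
    + \sum_(w in S :\ u :\ v | e u w) HL (S :\ u) w v.
Proof.
move=> uS vS uv; have vSu : v \in S :\ u by rewrite !inE eq_sym uv.
have uSv : u \in S :\ v by rewrite !inE uv.
rewrite /HL sumrB -mulr_suml -mulr_sumr.
rewrite (match_poly_rec e_sym e_irr R uS) (match_poly_rec e_sym e_irr R uSv).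
rewrite (sum_setD1_cond (e u) _ vSu) !(setD1C S v u).
rewrite [X in mu (S :\ u) * (_ - X)](eq_bigr (fun w => mu (S :\ u :\ w :\ v)));
  last first.
  by move=> w _; rewrite setD1C.
by case: (e u v); ring.
Qed.

Lemma HL_even_pos S u v : u \in S -> v \in S -> u != v -> even_pos t (HL S u v).
Proof.
move En : #|S| => n; elim: n S u En => [|n IHn] S u En uS vS uv.
  by move/cards0_eq: En uS => ->; rewrite inE.
rewrite HL_rec //; apply: even_posD.
  by case: ifP => _; [apply: even_pos_sqr | left].
apply: even_pos_sum => w /andP[]; rewrite !in_setD1 => /and3P[wv wu wS] _.
apply: IHn => //; rewrite ?in_setD1 ?wu ?wS ?(eq_sym v) ?uv //.
by move: En; rewrite (cardsD1 u) uS => -[].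
Qed.

(** The edge contributes the square of [mu (S :\ u :\ v)], which the other summands cannot cancel,
    so its order bounds that of the whole sum. *)
Lemma HL_edge S u v : u \in S -> v \in S -> e u v ->
  HL S u v != 0 /\ (mup t (HL S u v) <= (mult e t (S :\ u :\ v)).*2)%N.
Proof.
move=> uS vS euv; have uv : u != v by apply: contraTneq euv => ->; rewrite e_irr.
have q0 : mu (S :\ u :\ v) != 0 by exact: match_poly_neq0.
have -> : (mult e t (S :\ u :\ v)).*2 = mup t (mu (S :\ u :\ v) ^+ 2).
  by rewrite expr2 mupM // addnn.
rewrite HL_rec // euv; apply: mup_even_posD; rewrite ?expf_neq0 //.
  exact: even_pos_sqr.
apply: even_pos_sum => w /andP[]; rewrite !in_setD1 => /and3P[wv wu wS] _.
by apply: HL_even_pos; rewrite ?in_setD1 ?wu ?wS ?(eq_sym v) ?uv.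
Qed.

Lemma mult_mul A B : mup t (mu A * mu B) = (mult e t A + mult e t B)%N.
Proof. by rewrite mupM // match_poly_neq0. Qed.

(** When the first product of [HL] vanishes to strictly lower order, it decides the order of [HL],
    which is even. *)
Lemma mult_HL_parity S u v : u \in S -> v \in S -> u != v ->
  (mult e t (S :\ u) + mult e t (S :\ v) < mult e t S + mult e t (S :\ u :\ v))%N ->
  ~~ odd (mult e t (S :\ u) + mult e t (S :\ v)).
Proof.
move=> uS vS uv; rewrite -!mult_mul => lt.
have [||h0 <-] := mupB_lt _ _ lt; rewrite ?mulf_neq0 ?match_poly_neq0 //.
have [//|h] := even_pos_mup (HL_even_pos uS vS uv).
by rewrite /HL in h; rewrite h eqxx in h0.
Qed.

Lemma mult_HL_edge S u v n : u \in S -> v \in S -> e u v ->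
  (n <= mult e t (S :\ u) + mult e t (S :\ v))%N ->
  (n <= mult e t S + mult e t (S :\ u :\ v))%N ->
  (n <= (mult e t (S :\ u :\ v)).*2)%N.
Proof.
move=> uS vS euv; rewrite -!mult_mul => le1 le2.
have [h0] := HL_edge uS vS euv; apply: leq_trans.
by apply: mupB_ge; rewrite ?mulf_neq0 ?match_poly_neq0.
Qed.

Definition wronskian S u := mu (S :\ u) * (mu S)^`() - mu S * (mu (S :\ u))^`().

Lemma wronskianE S u : u \in S ->
  wronskian S u = mu (S :\ u) ^+ 2 + \sum_(v in S :\ u) HL S u v.
Proof.
move=> uS; rewrite /wronskian !match_poly_deriv (big_setD1 u) //=.
by rewrite /HL sumrB -!mulr_sumr; ring.
Qed.

Lemma wronskian_spec S u : u \in S -> even_pos t (wronskian S u) /\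
  (wronskian S u != 0 /\ (mup t (wronskian S u) <= (mult e t (S :\ u)).*2)%N).
Proof.
move=> uS; rewrite wronskianE //.
have -> : (mult e t (S :\ u)).*2 = mup t (mu (S :\ u) ^+ 2).
  by rewrite expr2 mult_mul addnn.
have e1 := even_pos_sqr t (mu (S :\ u)).
have e2 : even_pos t (\sum_(v in S :\ u) HL S u v).
  by apply: even_pos_sum => v /setD1P[vu vS]; apply: HL_even_pos; rewrite // eq_sym.
split; first exact: even_posD.
by apply: mup_even_posD; rewrite ?expf_neq0 ?match_poly_neq0.
Qed.

(** A drop of two or more from order [b.+2] would make the Wronskian vanish to order [b.*2.+1],
    against the bound of [wronskian_spec]. *)
Lemma mult_le_D1 S u : u \in S -> (mult e t S <= (mult e t (S :\ u)).+1)%N.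
Proof.
move=> uS; rewrite leqNgt; apply/negP => lt.
have [_ [w0]] := wronskian_spec uS; apply/negP; rewrite -ltnNge.
set b := mult e t (S :\ u) in lt *.
have [p pE] := mup_dvdP (match_poly_neq0 _ S) lt.
have [q qE] := mup_dvdP (match_poly_neq0 _ (S :\ u)) (leqnn b).
have [p' p'E] := deriv_mup (match_poly_neq0 _ S) lt.
have [q' q'E] := deriv_mup (match_poly_neq0 _ (S :\ u)) (leqnn b).
(* For [b = 0] the exponent [b.-1] from [deriv_mup] is not one below [b], which leaves a spare
   factor ['X - t] in the second product. *)
apply: (@mup_ge _ _ _ _ (q * p' - (if b is 0 then 'X - t%:P else 1) * p * q')) => //.
rewrite /wronskian p'E q'E {1}pE {1}qE.
have -> : (b.*2.+1 = b + b.+1)%N by lia.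
by case: (b) => [|c] /=; rewrite !exprD !exprS; ring.
Qed.

(** By [mult_le_D1], every term of the expansion at [u] has order at least that of [S :\ u] minus
    one. *)
Lemma mult_D1_le S u : u \in S -> (mult e t (S :\ u) <= (mult e t S).+1)%N.
Proof.
move=> uS; case Eb: (mult e t (S :\ u)) => [|b] //; rewrite ltnS.
rewrite /mult mup_geq ?match_poly_neq0 // (match_poly_rec e_sym e_irr R uS).
apply: dvdp_sub.
  by rewrite dvdp_mull // -mup_geq ?match_poly_neq0 //; rewrite -/(mult _ _ _) Eb.
apply: (big_ind (fun p => _ %| p)) => [|p q|w /andP[wS _]]; first exact: dvdp0.
  exact: dvdp_add.
by rewrite -mup_geq ?match_poly_neq0 // -ltnS -Eb mult_le_D1.
Qed.

(* At a [t]-essential vertex the simple pole of [mu (S :\ w) / mu S] has a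
   positive residue. *)
Lemma essential_lead S w p q : w \in S ->
  mu S = ('X - t%:P) ^+ (mult e t (S :\ w)).+1 * p ->
  mu (S :\ w) = ('X - t%:P) ^+ mult e t (S :\ w) * q ->
  p.[t] != 0 -> q.[t] != 0 -> 0 < p.[t] * q.[t].
Proof.
move=> wS pE qE p0 q0; have [ep _] := wronskian_spec wS.
set b := mult e t (S :\ w) in pE qE *.
(* [r] is the Wronskian divided by [('X - t) ^ (2b)]; the coefficient of [p * q] is
   [(b + 1) - b = 1]. *)
pose r := p * q + ('X - t%:P) * (q * p^`() - p * q^`()).
have rt : r.[t] = p.[t] * q.[t].
  by rewrite hornerD !hornerM hornerXsubC subrr mul0r addr0.
rewrite -rt; apply: (@even_pos_lead _ _ b.*2 _ _ ep); last by rewrite rt mulf_neq0.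
rewrite /wronskian pE qE deriv_XsubCX_mul /r -addnn exprD.
case: (b) => [|c]; first by rewrite !expr0 !expr1 !mul1r scale1r; ring.
rewrite deriv_XsubCX_mul -!mul_polyC !rmorph_nat !exprS -[c.+2]addn1 natrD.
by ring.
Qed.

(** In the expansion at [u], each neighbour contributes, to the critical order, a value whose sign
    is that of [f.[t]] or zero, and it is nonzero exactly for essential neighbours. Hence nothing
    cancels. *)
Lemma positive_nbrP S u : u \in S ->
  mult e t (S :\ u) = (mult e t S).+1 <->
  exists w, [/\ w \in S :\ u, e u w &
               (mult e t (S :\ u :\ w)).+1 = mult e t (S :\ u)].
Proof.
move=> uS; case Eb: (mult e t (S :\ u)) => [|b].
  by split=> // -[w []].
set H := S :\ u in Eb *.
have [f fE f0] := mup_factor t (match_poly_neq0 R H).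
rewrite -/(mult e t H) Eb in fE.
(* [g] is the cofactor of [mu (H :\ w)] at exponent [b]; the sign statement is [essential_lead] when
   [w] is essential in [H], and otherwise [g] vanishes at [t]. *)
have gP w : exists g, w \in H -> [/\ mu (H :\ w) = ('X - t%:P) ^+ b * g,
   0 <= f.[t] * g.[t] & (0 < f.[t] * g.[t]) = ((mult e t (H :\ w)).+1 == b.+1)].
  case wH: (w \in H); last by exists 0.
  have := mult_le_D1 wH; rewrite Eb ltnS leq_eqVlt => /orP[/eqP bE|lt].
    have [g gE g0] := mup_factor t (match_poly_neq0 R (H :\ w)).
    rewrite -/(mult e t (H :\ w)) -bE in gE; exists g => _.
    have pos : 0 < f.[t] * g.[t] by apply: (essential_lead wH); rewrite // -bE.
    by rewrite ltW // pos -bE eqxx.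
  have [g gE] := mup_dvdP (match_poly_neq0 R (H :\ w)) lt.
  exists (('X - t%:P) * g) => _.
  rewrite gE hornerM hornerXsubC subrr mul0r mulr0 lexx ltxx.
  by split; rewrite // ?exprSr ?mulrA //; apply/esym/eqP; lia.
have /fin_all_exists[g gE] := gP.
pose r := 'X * (('X - t%:P) * f) - \sum_(w in H | e u w) g w.
have rE : mu S = ('X - t%:P) ^+ b * r.
  rewrite (match_poly_rec e_sym e_irr R uS) fE exprSr /r [RHS]mulrBr mulr_sumr.
  congr (_ - _); first by ring.
  by apply: eq_bigr => w /andP[wH _]; case: (gE w wH).
have rt : f.[t] * r.[t] = - \sum_(w in H | e u w) f.[t] * (g w).[t].
  rewrite /r hornerD hornerN !hornerM hornerXsubC subrr mul0r mulr0 sub0r.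
  by rewrite horner_sum mulrN mulr_sumr.
have nneg w : (w \in H) && e u w -> 0 <= f.[t] * (g w).[t].
  by move=> /andP[wH _]; case: (gE w wH).
split=> [[bE]|[w [wH euw wE]]].
  have: r.[t] != 0.
    apply/negP => /factor_theorem[s sE].
    have : (b < b)%N; last by rewrite ltnn.
    rewrite {2}bE; apply: (@mup_ge _ _ _ _ s); first exact: match_poly_neq0.
    by rewrite rE sE exprSr; ring.
  move=> r0; have : \sum_(w in H | e u w) f.[t] * (g w).[t] != 0.
    by rewrite -oppr_eq0 -rt mulf_neq0.
  rewrite psumr_neq0 // => /hasP[w _ /andP[/andP[wH euw]]].
  by case: (gE w wH) => _ _ -> /eqP; exists w.
congr _.+1; rewrite /mult rE mup_XsubCX_mul //.
suff : f.[t] * r.[t] != 0 by rewrite mulf_eq0 negb_or => /andP[].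
rewrite rt oppr_eq0 psumr_neq0 //; apply/hasP; exists w.
  by rewrite mem_index_enum.
by rewrite wH euw; case: (gE w wH) => _ _ ->; rewrite wE eqxx.
Qed.

Lemma exists_essential S : (0 < mult e t S)%N ->
  exists2 v, v \in S & (mult e t (S :\ v)).+1 = mult e t S.
Proof.
move=> m0; case: (boolP [exists v in S, (mult e t (S :\ v)).+1 == mult e t S]).
  by case/exists_inP=> v vS /eqP; exists v.
rewrite negb_exists_in => /forall_inP nE.
have [p pE p0] := mup_factor t (match_poly_neq0 R S).
rewrite -/(mult e t S) in pE; case Ea: (mult e t S) m0 => [//|a] _.
rewrite Ea in pE; have dE := deriv_XsubCX_mul t a p.
rewrite -pE match_poly_deriv in dE.
pose q := a.+1%:R *: p + ('X - t%:P) * p^`().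
have qt : q.[t] != 0.
  rewrite hornerD hornerZ hornerM hornerXsubC subrr mul0r addr0.
  by rewrite mulf_neq0 // pnatr_eq0.
have d : ('X - t%:P) ^+ a.+1 %| ('X - t%:P) ^+ a * q.
  rewrite /q -dE; apply: (big_ind (fun p => _ %| p)) => [|x y|v vS].
  - exact: dvdp0.
  - exact: dvdp_add.
  rewrite -mup_geq ?match_poly_neq0 //.
  have := nE v vS; have := mult_le_D1 vS; rewrite Ea => h1 h2.
  by rewrite -/(mult _ _ _); lia.
have q0 : q != 0 by apply: contraNneq qt => ->; rewrite horner0.
move: d; rewrite -mup_geq ?mulf_neq0 ?XsubCX_eq0 //.
by rewrite mup_XsubCX_mul // ltnn.
Qed.

Lemma mult_setU A B : [disjoint A & B] ->
  (forall x y, x \in A -> y \in B -> ~~ e x y) ->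
  mult e t (A :|: B) = (mult e t A + mult e t B)%N.
Proof. by move=> dAB nAB; rewrite /mult match_polyU // mult_mul. Qed.

End HeilmannLieb.
End MatchingIdentities.

(* Hypotheses about vertices make [lia] split on irrelevant booleans. *)
Ltac lia_nat :=
  repeat match goal with
  | H : is_true (_ \in _) |- _ => clear H
  | H : is_true (~~ (?a == ?b)) |- _ =>
      lazymatch type of a with nat => fail | _ => clear H end
  end; lia.

(** * Stability under deletion of a special vertex *)

Section Stability.
Set Implicit Arguments.
Unset Strict Implicit.
Variables (R : realFieldType) (T : finType) (e : rel T) (t : R).
Hypotheses (e_sym : symmetric e) (e_irr : irreflexive e).
Implicit Types (S : {set T}) (u v w x y : T).
Local Notation m := (mult e t).

Let le_D1 S u : u \in S -> (m S <= (m (S :\ u)).+1)%N.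
Proof. exact: mult_le_D1. Qed.
Let D1_le S u : u \in S -> (m (S :\ u) <= (m S).+1)%N.
Proof. exact: mult_D1_le. Qed.

(** By interlacing both products in [HL] have order at least [2 (m S - 1)], while the edge caps the
    order of [HL] at [2 m (S :\ u :\ v)]. *)
Lemma mult_edge_ge S u v : u \in S -> v \in S -> e u v ->
  (m S <= (m (S :\ u :\ v)).+1)%N.
Proof.
move=> uS vS euv; have uv : u != v by apply: contraTneq euv => ->; rewrite e_irr.
have vSu : v \in S :\ u by rewrite in_setD1 eq_sym uv.
have h1 := le_D1 uS; have h2 := le_D1 vS; have h3 := le_D1 vSu.
have := @mult_HL_edge T e e_sym e_irr R t S u v ((m S).-1).*2 uS vS euv.
by lia.
Qed.

(** If [u] were neutral, [m (S :\ u) + m (S :\ w)] would be odd; parity then forces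
    [m (S :\ u :\ w) = m S - 1], which violates the bound given by the edge. *)
Lemma special_is_positive S u w : u \in S -> w \in S -> e u w ->
  (m (S :\ w)).+1 = m S -> (m (S :\ u)).+1 != m S -> m (S :\ u) = (m S).+1.
Proof.
move=> uS wS euw wess uness.
have uw : u != w by apply: contraTneq euw => ->; rewrite e_irr.
have wSu : w \in S :\ u by rewrite in_setD1 eq_sym uw.
have h1 := le_D1 uS; have h2 := D1_le uS; have h3 := le_D1 wSu.
have h4 := @mult_HL_edge T e e_sym e_irr R t S u w (m S + (m S).-1)%N uS wS euw.
have h5 := @mult_HL_parity T e e_sym e_irr R t S u w uS wS uw.
by lia.
Qed.

Lemma essential_D1 S v w : v \in S -> w \in S -> v != w ->
  (m (S :\ w)).+1 = m S -> (m (S :\ v)).+1 != m S ->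
  (m (S :\ v :\ w)).+1 = m (S :\ v).
Proof.
move=> vS wS vw wess vness.
have wSv : w \in S :\ v by rewrite in_setD1 eq_sym vw.
have vSw : v \in S :\ w by rewrite in_setD1 vw.
have h1 := le_D1 vS; have h2 := D1_le vS; have h3 := le_D1 wSv.
have h4 := D1_le vSw; rewrite (setD1C S w v) in h4.
have h5 := @mult_HL_parity T e e_sym e_irr R t S v w vS wS vw.
by lia.
Qed.

(** Here [u] is special in [S] with essential neighbour [w]. As [u] is positive, its staying
    positive in [S :\ v] amounts to [v] changing [m] equally in [S] and in [S :\ u]. *)
Definition stable S := forall u w v, u \in S -> w \in S -> v \in S -> v != u ->
  e u w -> (m (S :\ w)).+1 = m S -> (m (S :\ u)).+1 != m S ->
  m (S :\ u :\ v) = (m (S :\ v)).+1.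

(* Transitivity of "lying in the same critical component", which for
   essential vertices means that deleting both lowers the multiplicity by
   less than two. *)
Lemma essential_trans S f u w : stable (S :\ f) ->
  f \in S -> u \in S -> w \in S -> f != u -> f != w -> e u w ->
  (m (S :\ f)).+1 = m S -> (m (S :\ u)).+1 = m S ->
  (m S <= (m (S :\ f :\ u)).+1)%N -> (m S <= (m (S :\ f :\ w)).+1)%N.
Proof.
move=> stabf fS uS wS fu fw euw fess uess mfu.
rewrite leqNgt; apply/negP => mfw.
have uSf : u \in S :\ f by rewrite in_setD1 eq_sym fu.
have wSf : w \in S :\ f by rewrite in_setD1 eq_sym fw.
have fSu : f \in S :\ u by rewrite in_setD1 fu.
have wessf : (m (S :\ f :\ w)).+1 = m (S :\ f) by have := le_D1 wSf; lia_nat.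
have unessf : (m (S :\ f :\ u)).+1 != m (S :\ f) by lia_nat.
have upos := special_is_positive uSf wSf euw wessf unessf.
(* As [u] is special in [S :\ f], the vertex [f] is positive in [S :\ u] and so has an essential
   neighbour [y] in [S :\ u :\ f]. Stability in [S :\ f] then makes deleting the adjacent [f], [y]
   lower [m S] by two. *)
have [|y [yS efy yess]] := (positive_nbrP e_sym e_irr t fSu).1.
  by rewrite setD1C; lia_nat.
have yu : y != u by move: yS; rewrite !in_setD1 => /and3P[].
have yS' : y \in S by move: yS; rewrite !in_setD1 => /and3P[].
have yf : y != f by move: yS; rewrite !in_setD1 => /and3P[].
have ySf : y \in S :\ f by rewrite in_setD1 yf.
have := stabf u w y uSf wSf ySf yu euw wessf unessf.
have := mult_edge_ge fS yS' efy.
by move: yess; rewrite (setD1C S u f); lia_nat.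
Qed.

Lemma stability S : stable S.
Proof.
move En : #|S| => n; elim/ltn_ind: n S En => n IHn S En.
move=> u w v uS wS vS vu euw wess uness.
have uw : u != w by apply: contraTneq euw => ->; rewrite e_irr.
have upos := special_is_positive uS wS euw wess uness.
have vSu : v \in S :\ u by rewrite in_setD1 vu.
have uSv : u \in S :\ v by rewrite in_setD1 eq_sym vu.
have h1 := le_D1 vSu; have h2 := D1_le vSu.
have h3 := le_D1 uSv; have h4 := D1_le uSv.
have h5 := le_D1 vS; have h6 := D1_le vS.
rewrite (setD1C S v u) in h3 h4.
have [vess|vness] := eqVneq (m (S :\ v)).+1 (m S); first by lia_nat.
have vw : v != w by apply: contraNneq vness => ->; rewrite wess.
have wSv : w \in S :\ v by rewrite in_setD1 eq_sym vw.
have wessv := essential_D1 vS wS vw wess vness.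
have [uessv|unessv] := eqVneq (m (S :\ v :\ u)).+1 (m (S :\ v)); last first.
  by rewrite setD1C; apply: special_is_positive euw wessv unessv.
(* The remaining case has [u] essential in [S :\ v]. Counting gives [m (S :\ v) = m S + 1], so [v]
   is positive in [S :\ w]. *)
exfalso; rewrite (setD1C S v u) in uessv.
have vSw : v \in S :\ w by rewrite in_setD1 vw.
have [|y [yS evy yess]] := (positive_nbrP e_sym e_irr t vSw).1.
  by rewrite setD1C; lia_nat.
have [yv yw yS'] : [/\ y != v, y != w & y \in S].
  by move: yS; rewrite !in_setD1 => /and3P[].
have ySv : y \in S :\ v by rewrite in_setD1 yv.
have wSvy : w \in S :\ v :\ y by rewrite in_setD1 eq_sym yw.
rewrite (setD1C S w v) (setD1C (S :\ v) w y) in yess.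
have h7 := D1_le ySv; have h8 := le_D1 ySv.
have h9 := le_D1 wSvy.
have [yu|yu] := eqVneq y u.
  have := mult_edge_ge uSv wSv euw.
  by rewrite -yu; lia_nat.
(* Otherwise [y] would be essential in [S :\ u :\ v], and its neighbour [v] positive in [S :\ u]. *)
have uy : (m S <= m (S :\ v :\ y :\ u))%N.
  rewrite leqNgt; apply/negP => lt.
  have ySuv : y \in S :\ u :\ v by rewrite !in_setD1 yv yu.
  have Eset : S :\ u :\ v :\ y = S :\ v :\ y :\ u by rewrite (setD1C S u) setD1C.
  have := le_D1 ySuv; rewrite Eset => h10.
  have : m (S :\ u :\ v) = (m (S :\ u)).+1; last by lia_nat.
  apply: (positive_nbrP e_sym e_irr t vSu).2; exists y; rewrite Eset.
  by split=> //; lia_nat.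
(* In [S :\ v], deleting [y] and [u] costs at most one, so transitivity along the edge from [u] to
   [w] gives the same for [y] and [w]; but the choice of [y] makes that pair cost two. *)
have := @essential_trans (S :\ v) y u w.
rewrite (setD1C S v u) => /(_ _ ySv uSv wSv yu yw euw) trans.
have: (m (S :\ v) <= (m (S :\ v :\ y :\ w)).+1)%N; last by lia_nat.
apply: trans; try lia_nat.
apply: (IHn #|S :\ v :\ y|) => //.
by rewrite -En (cardsD11 vS ySv).
Qed.

End Stability.

(** * Deleting all special vertices, and the resulting components *)

Section SpecialSet.
Set Implicit Arguments.
Unset Strict Implicit.
Variables (R : realFieldType) (T : finType) (e : rel T) (t : R).
Hypotheses (e_sym : symmetric e) (e_irr : irreflexive e).
Implicit Types (S A B C : {set T}) (u v w x y : T).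
Local Notation m := (mult e t).

(** Relative to an induced subgraph, because special vertices are deleted one at a time. *)
Definition special_in S u := [/\ u \in S, (m (S :\ u)).+1 != m S &
  exists w, [/\ w \in S, e u w & (m (S :\ w)).+1 = m S]].

Lemma special_in_positive S u : special_in S u -> m (S :\ u) = (m S).+1.
Proof.
by case=> uS uness [w [wS euw wess]]; apply: special_is_positive euw wess uness.
Qed.

Lemma special_in_stable S u v : special_in S u -> v \in S -> v != u ->
  m (S :\ u :\ v) = (m (S :\ v)).+1.
Proof.
case=> uS uness [w [wS euw wess]] vS vu.
exact: (stability e_sym e_irr (t := t)) uS wS vS vu euw wess uness.
Qed.

(** Stability raises all the multiplicities involved by one, and the essential witness survives
    because the positive [u] is not essential. *)
Lemma special_in_D1 S u v : special_in S u -> v != u -> special_in S v ->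
  special_in (S :\ u) v.
Proof.
move=> su vu [vS vness [w [wS evw wess]]].
have mu := special_in_positive su.
have wu : w != u by apply/eqP => wu; move: mu wess; rewrite wu; clear; lia.
split; first by rewrite in_setD1 vu.
  by rewrite (special_in_stable su vS vu) mu eqSS.
exists w; split; rewrite ?in_setD1 ?wu //.
by rewrite (special_in_stable su wS wu) mu wess.
Qed.

Lemma mult_setD_special S B : (forall u, u \in B -> special_in S u) ->
  m (S :\: B) = (m S + #|B|)%N /\
  (forall x, x \in S :\: B -> m ((S :\: B) :\ x) = (m (S :\ x) + #|B|)%N).
Proof.
move En : #|B| => n; elim: n S B En => [|n IHn] S B En spB.
  have -> : B = set0 by exact: cards0_eq.
  by rewrite setD0 addn0; split=> // x _; rewrite addn0.
have [u uB] : exists u, u \in B by apply/card_gt0P; rewrite En.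
have su := spB u uB; have BE : #|B :\ u| = n.
  by move: En; rewrite (cardsD1 u) uB => -[].
have SE : S :\: B = (S :\ u) :\: (B :\ u) by rewrite setDDl setD1K.
have [|IH1 IH2] := IHn (S :\ u) (B :\ u) BE.
  by move=> v /setD1P[vu vB]; apply: special_in_D1 (spB v vB).
rewrite SE IH1 special_in_positive // addSnnS; split=> // x xSB.
have xu : x != u by move: xSB; rewrite -SE inE; case: eqP => // ->; rewrite uB.
have xS : x \in S by move: xSB; rewrite -SE inE => /andP[].
by rewrite IH2 // special_in_stable // addSnnS.
Qed.

Lemma mult_setD_le S B : B \subset S -> (m (S :\: B) <= m S + #|B|)%N.
Proof.
move En : #|B| => n; elim: n B En => [|n IHn] B En sB.
  by have -> : B = set0 by [exact: cards0_eq]; rewrite setD0 addn0.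
have [u uB] : exists u, u \in B by apply/card_gt0P; rewrite En.
have BE : #|B :\ u| = n by move: En; rewrite (cardsD1 u) uB => -[].
have SE : S :\: B = (S :\: (B :\ u)) :\ u by rewrite setDDl setUC setD1K.
have uS : u \in S :\: (B :\ u) by rewrite !inE eqxx (subsetP sB).
rewrite SE addnS; apply: leq_trans (mult_D1_le e_sym e_irr t uS) _.
by rewrite ltnS; apply: IHn; rewrite // (subset_trans (subD1set _ _)).
Qed.

Lemma special_inP u : u \in Aset e t <-> special_in [set: T] u.
Proof.
rewrite inE /special /essential -!setTD; split.
  case/andP=> uness /existsP[w /andP[euw /eqP]]; rewrite -setTD => wess.
  by split=> //; exists w.
case=> _ -> [w [_ euw wess]]; apply/existsP; exists w.
by rewrite euw -setTD wess eqxx.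
Qed.

Lemma comp_sub S x : x \in S -> Defs.comp e S x \subset S.
Proof.
move=> xS; apply/subsetP => y; rewrite inE => /connectP[p].
elim: p x xS => [|z p IHp] x xS /=; first by move=> _ ->.
by case/andP=> /and3P[_ zS _]; apply: IHp.
Qed.

Lemma rel_on_sym S : symmetric (rel_on e S).
Proof. by move=> x y; rewrite /rel_on /= e_sym andbCA. Qed.

Lemma comp_eq S x y : y \in Defs.comp e S x -> Defs.comp e S y = Defs.comp e S x.
Proof.
rewrite inE => xy; apply/setP => z; rewrite !inE.
by rewrite (same_connect (sym_connect_sym (rel_on_sym S)) xy).
Qed.

Lemma comp_no_edge S x y z : x \in S -> y \in Defs.comp e S x ->
  z \in S :\: Defs.comp e S x -> ~~ e y z.
Proof.
move=> xS yC /setDP[zS]; apply: contra => eyz.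
have yS := subsetP (comp_sub xS) y yC.
move: yC; rewrite !inE => xy; apply: connect_trans xy (connect1 _).
by rewrite /rel_on /= yS zS.
Qed.

Lemma mult_comp S x A B : x \in S -> A \subset Defs.comp e S x ->
  B \subset S :\: Defs.comp e S x -> m (A :|: B) = (m A + m B)%N.
Proof.
move=> xS sA sB; apply: mult_setU => //.
  apply: disjointWl sA _; apply: disjointWr sB _.
  by rewrite disjoints_subset; apply/subsetP => y; rewrite !inE => ->.
by move=> y z /(subsetP sA) yC /(subsetP sB); apply: comp_no_edge xS yC.
Qed.

Lemma mult_comp_split S x A : x \in S ->
  m (S :\: A) = (m (Defs.comp e S x :\: A) + m (S :\: Defs.comp e S x :\: A))%N.
Proof.
move=> xS; rewrite -(mult_comp xS (subsetDl _ _) (subsetDl _ _)); congr m.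
rewrite -setDUl; congr (_ :\: A); apply/setP => z; rewrite in_setU in_setD.
by have [/(subsetP (comp_sub xS))|] := boolP (z \in Defs.comp e S x).
Qed.

Lemma mult_comp_setD S x A : x \in S -> A \subset Defs.comp e S x ->
  m (S :\: A) = (m (Defs.comp e S x :\: A) + m (S :\: Defs.comp e S x))%N.
Proof.
move=> xS sA; rewrite (mult_comp_split A xS) setDDl.
by have /setUidPl -> := sA.
Qed.

(** A non-special neighbour of an essential vertex is essential, so essentiality spreads along paths
    avoiding the special vertices. *)
Lemma comp_essential x y : connect (rel_on e (~: Aset e t)) x y ->
  essential e t x -> essential e t y.
Proof.
case/connectP=> p; elim: p x => [|z p IHp] x /=; first by move=> _ ->.
case/andP=> /and3P[xA zA exz] pz lz xess; apply: IHp pz lz _.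
move: zA; rewrite !inE /special negb_and negbK => /orP[//|/negP[]].
by apply/existsP; exists x; rewrite e_sym exz.
Qed.

Lemma mult_deleteA : m (~: Aset e t) = (m [set: T] + #|Aset e t|)%N.
Proof.
by rewrite -setTD; case: (@mult_setD_special setT (Aset e t)) => // u /special_inP.
Qed.

Lemma mult_deleteA_D1 x : x \notin Aset e t ->
  m (~: Aset e t :\ x) = (m (~: [set x]) + #|Aset e t|)%N.
Proof.
move=> xA; rewrite -!setTD.
case: (@mult_setD_special setT (Aset e t)) => [u /special_inP //|_ -> //].
by rewrite !inE andbT; move: xA; rewrite inE.
Qed.

(** A component with positive multiplicity has an essential vertex [y], which is essential in the
    whole graph because restoring the special vertices shifts both counts by [#|Aset e t|]. Then [x]
    would be essential too. *)
Lemma positive_comp_mult0 x : x \notin Aset e t -> positive e t x ->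
  m (Defs.comp e (~: Aset e t) x) = 0%N.
Proof.
move=> xA xpos; set B := ~: Aset e t; set C := Defs.comp e B x.
have xB : x \in B by rewrite in_setC.
apply/eqP; rewrite -leqn0 leqNgt; apply/negP => C0.
have [y yC yess] := exists_essential e_sym e_irr C0.
have sCB := comp_sub xB; have yA : y \notin Aset e t.
  by rewrite -in_setC; apply: (subsetP sCB).
have := mult_comp_setD xB (sub0set _); rewrite !setD0 -/C => E1.
have : [set y] \subset C by rewrite sub1set.
move=> /(mult_comp_setD xB); rewrite -/C => E2.
have ess_y : essential e t y.
  move: (mult_deleteA_D1 yA) mult_deleteA; rewrite /essential -/B E1 E2.
  by move: yess; rewrite -/C; clear; lia.
have : essential e t x.
  apply: comp_essential ess_y; rewrite (sym_connect_sym (rel_on_sym _)).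
  by move: yC; rewrite inE.
by move: xpos; rewrite /positive /essential => /eqP ->; clear; lia.
Qed.

End SpecialSet.

(** * Adding edges at special vertices *)

Section AddEdges.
Set Implicit Arguments.
Unset Strict Implicit.
Variables (R : realFieldType) (T : finType) (t : R).
Implicit Types (e : rel T) (S A B : {set T}) (u v : T).

Lemma eq_in_mult e e' S : {in S &, e =2 e'} -> mult e t S = mult e' t S.
Proof.
move=> ee; rewrite /mult /match_poly; congr mup.
apply: eq_bigr => r _; congr ((_ * _%:R) *: _).
apply: eq_card => M; rewrite !inE; congr (_ && _).
congr (_ && _); apply: eq_forallb => E; congr (_ ==> _).
apply: eq_existsb => x; apply: eq_existsb => y.
by case xS: (x \in S); case yS: (y \in S) => //=; rewrite ee.
Qed.

(** New edges at [u] leave [S :\ u] unchanged, so the essential neighbour witnessing positivity of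
    [u] still does so, and [m S] is recovered as [m (S :\ u) - 1]. *)
Lemma mult_add_edges e e' u S :
  symmetric e -> irreflexive e -> symmetric e' -> irreflexive e' ->
  subrel e e' -> {in [set~ u] &, e =2 e'} ->
  (u \in S -> mult e t (S :\ u) = (mult e t S).+1) ->
  mult e' t S = mult e t S.
Proof.
move=> es ei es' ei' sub ee upos.
have eqm A : u \notin A -> mult e' t A = mult e t A.
  move=> uA; apply/esym/eq_in_mult => x y xA yA; apply: ee; rewrite !inE.
    by apply: contraNneq uA => <-.
  by apply: contraNneq uA => <-.
have [uS|] := boolP (u \in S); last exact: eqm.
have [w [wS euw wess]] := (positive_nbrP es ei t uS).1 (upos uS).
have wess' : (mult e' t (S :\ u :\ w)).+1 = mult e' t (S :\ u).
  by rewrite !eqm // !inE eqxx // andbF.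
have := (positive_nbrP es' ei' t uS).2 (ex_intro _ w (And3 wS (sub _ _ euw) wess')).
by rewrite eqm ?setD11 // upos // => -[].
Qed.

(** Taking [B] to be [Aset e t] gives [Srel e t]; a general [B] allows special vertices to be joined
    one by one. *)
Definition join_rel e B : rel T :=
  [rel w z | e w z || ((w != z) && ((w \in B) || (z \in B)))].

Lemma join_rel_sym e B : symmetric e -> symmetric (join_rel e B).
Proof.
move=> es x y; rewrite /join_rel /= es eq_sym.
by rewrite [(x \in B) || _]orbC.
Qed.

Lemma join_rel_irr e B : irreflexive e -> irreflexive (join_rel e B).
Proof. by move=> ei x; rewrite /join_rel /= ei eqxx. Qed.

Lemma mult_join_rel e B : symmetric e -> irreflexive e -> B \subset Aset e t ->
  mult (join_rel e B) t [set: T] = mult e t [set: T] /\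
  (forall v, mult (join_rel e B) t ([set: T] :\ v) = mult e t ([set: T] :\ v)).
Proof.
move=> es ei; move En : #|B| => n; elim: n B En => [|n IHn] B En sB.
  have eqm S : mult (join_rel e B) t S = mult e t S.
    apply: eq_in_mult => x y _ _; rewrite /join_rel /= (cards0_eq En) !inE andbF.
    by rewrite orbF.
  by split=> [|v]; rewrite eqm.
have [u uB] : exists u, u \in B by apply/card_gt0P; rewrite En.
have BE : #|B :\ u| = n by move: En; rewrite (cardsD1 u) uB => -[].
have [|IH1 IH2] := IHn _ BE; first by rewrite (subset_trans (subD1set _ _)).
set e1 := join_rel e (B :\ u) in IH1 IH2.
have e1s : symmetric e1 by exact: join_rel_sym.
have e1i : irreflexive e1 by exact: join_rel_irr.
have su : special_in e1 t setT u.
  have /special_inP[_ uness [w [_ euw wess]]] := subsetP sB u uB.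
  split; rewrite ?IH1 ?IH2 //; exists w; rewrite ?IH1 ?IH2; split=> //.
  by rewrite /e1 /join_rel /= euw.
have step S : (u \in S -> mult e1 t (S :\ u) = (mult e1 t S).+1) ->
    mult (join_rel e B) t S = mult e1 t S.
  apply: mult_add_edges => //; [exact: join_rel_sym | exact: join_rel_irr | |].
    move=> x y; rewrite /e1 /join_rel /= => /orP[->//|/andP[-> /orP[]]].
      by case/setD1P=> _ ->; rewrite orbT.
    by case/setD1P=> _ ->; rewrite !orbT.
  by move=> x y; rewrite !inE => xu yu; rewrite /e1 /join_rel /= !in_setD1 xu yu.
split=> [|v].
  by rewrite step // => _; apply: special_in_positive.
(* By stability [u] remains positive after [v] is deleted. *)
rewrite step // => uv; rewrite setD1C; apply: special_in_stable => //.
by move: uv; rewrite !inE andbT eq_sym.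
Qed.

End AddEdges.

(** * Multiplicities in the graph [S_theta(G)] *)

Section JoinedGraph.
Set Implicit Arguments.
Unset Strict Implicit.
Variables (R : realFieldType) (T : finType) (e : rel T) (t : R).
Hypotheses (e_sym : symmetric e) (e_irr : irreflexive e).
Local Notation A := (Aset e t).
Local Notation B := (~: Aset e t).
Local Notation m := (mult e t).
Local Notation m' := (mult (Srel e t) t).
Local Notation V := [set: T].

Let s_sym : symmetric (Srel e t).
Proof. exact: join_rel_sym. Qed.
Let s_irr : irreflexive (Srel e t).
Proof. exact: join_rel_irr. Qed.

Lemma mult_Srel : m' V = m V.
Proof. by case: (mult_join_rel e_sym e_irr (subxx A)). Qed.

Lemma mult_Srel_D1 v : m' (V :\ v) = m (V :\ v).
Proof. by case: (mult_join_rel e_sym e_irr (subxx A)). Qed.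

Lemma mult_Srel_sub (S : {set T}) : S \subset B -> m' S = m S.
Proof.
move=> SB; apply: eq_in_mult => x y /(subsetP SB) + /(subsetP SB).
by rewrite !in_setC /Srel /= => /negPf-> /negPf->; rewrite andbF orbF.
Qed.

Lemma special_in_Srel u : u \in A -> special_in (Srel e t) t V u.
Proof.
move=> /special_inP[_ uness [w [_ euw wess]]].
split; rewrite ?mult_Srel ?mult_Srel_D1 //.
exists w; rewrite ?mult_Srel ?mult_Srel_D1; split=> //.
by rewrite /Srel /= euw.
Qed.

(* A vertex of [A] is joined to everything, hence to any essential vertex,
   so it is positive as long as the multiplicity is at least two. *)
Lemma mult_Srel_delete_special (S X : {set T}) : X \subset A -> X \subset S ->
  (2 <= m' S)%N -> (m' S + #|X| <= m' (S :\: X))%N.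
Proof.
move En : #|X| => n; elim: n X En => [|n IHn] X En XA XS mS.
  by rewrite (cards0_eq En) setD0 addn0.
have [w wX] : exists w, w \in X by apply/card_gt0P; rewrite En.
have XE : #|X :\ w| = n by move: En; rewrite (cardsD1 w) wX => -[].
have sX (Z : {set T}) : X \subset Z -> X :\ w \subset Z.
  exact: subset_trans (subD1set _ _).
have {IHn} := IHn _ XE (sX _ XA) (sX _ XS) mS.
set Y := S :\: (X :\ w) => IH.
have -> : S :\: X = Y :\ w by rewrite /Y setDDl setUC setD1K.
have wY : w \in Y by rewrite !inE eqxx (subsetP XS).
have le := mult_le_D1 s_sym s_irr t wY.
have [|y yY yess] := @exists_essential T (Srel e t) s_sym s_irr R t (Y :\ w).
  by move: le IH mS; clear; lia.
have ewy : Srel e t w y.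
  rewrite /Srel /= (subsetP XA) // orTb andbT eq_sym.
  by case/setD1P: yY => -> _; rewrite orbT.
have -> := (positive_nbrP s_sym s_irr t wY).2 (ex_intro _ y (And3 yY ewy yess)).
by rewrite addnS ltnS.
Qed.

Lemma comp_of_mem C u : is_comp e B C -> u \in C ->
  u \in B /\ C = Defs.comp e B u.
Proof.
case=> x xB -> uC; split; first exact: (subsetP (comp_sub e xB) u uC).
exact/esym/(comp_eq e_sym).
Qed.

Lemma is_comp_comp u : u \in B -> is_comp e B (Defs.comp e B u).
Proof. by exists u. Qed.

(** Deleting the special vertices gains at most [#|A|], and exactly [#|A|] once the multiplicity is
    at least two. Conversely, a total gain of [#|A| + 2] requires the maximal gain of two from [u]
    and [v]. *)
Lemma mult_delete2 u v : u \in B -> v \in B -> u != v ->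
  (m' (V :\ u :\ v) = m V + 2 <-> m (B :\ u :\ v) = m B + 2)%N.
Proof.
move=> uB vB uv; rewrite mult_deleteA //.
have AS : A \subset V :\ u :\ v.
  apply/subsetP => x xA; rewrite !in_setD1 in_setT andbT.
  by apply/andP; split; apply: contraTneq xA => ->; rewrite -in_setC.
have SE : B :\ u :\ v = (V :\ u :\ v) :\: A.
  apply/setP => z; rewrite !(in_setD1, in_setD, in_setC, in_setT) andbT.
  by case: (z \in A); rewrite ?andbF ?andbT.
have -> : m (B :\ u :\ v) = m' ((V :\ u :\ v) :\: A).
  by rewrite -SE mult_Srel_sub // (subset_trans (subD1set _ _)) ?subD1set.
split=> mE.
  have := mult_Srel_delete_special (subxx A) AS.
  have := mult_setD_le t s_sym s_irr AS.
  by move: mE; clear; lia.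
have := mult_setD_le t s_sym s_irr AS.
have vVu : v \in V :\ u by rewrite !inE eq_sym uv.
have uV : u \in V by rewrite inE.
have := mult_D1_le s_sym s_irr t vVu; have := mult_D1_le s_sym s_irr t uV.
by rewrite mult_Srel; move: mE; clear; lia.
Qed.

End JoinedGraph.

(** * The four cases, by membership in the special set and in components *)

Theorem theorem5p13 (R : realFieldType) (T : finType) (e : rel T)
    (e_sym : symmetric e) (e_irr : irreflexive e) (theta : R) (u v : T) :
  u != v ->
  (mult (Srel e theta) theta ([set: T] :\ u :\ v)%SET
     = (mult (Srel e theta) theta [set: T] + 2)%N
   <->
   [\/ (u \in Aset e theta /\ v \in Aset e theta),
       ((u \in Aset e theta /\ v \in Pset e theta) \/
        (v \in Aset e theta /\ u \in Pset e theta)),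
       (u \in Pset e theta /\ v \in Pset e theta /\
        exists C1 C2 : {set T},
          [/\ is_comp e (~: Aset e theta) C1, mult e theta C1 = 0%N,
              is_comp e (~: Aset e theta) C2, mult e theta C2 = 0%N &
              [/\ C1 != C2, u \in C1 & v \in C2]])
     | exists C : {set T},
          [/\ is_comp e (~: Aset e theta) C, mult e theta C = 0%N,
              u \in C, v \in C & mult e theta (C :\ u :\ v) = 2%N]]).
Proof.
move=> uv; rewrite (mult_Srel theta e_sym e_irr).
set k := mult e theta setT; set A := Aset e theta.
have s_sym : symmetric (Srel e theta) := join_rel_sym A e_sym.
have s_irr : irreflexive (Srel e theta) := join_rel_irr A e_irr.
have PE x : (x \in Pset e theta) =
    (mult e theta (setT :\ x) == k.+1) && (x \notin A).
  by rewrite !inE /positive setTD.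
have posA x : x \in A -> mult e theta (setT :\ x) = k.+1.
  by move=> /special_inP; apply: special_in_positive.
have Apos x y : x \in A -> y != x -> mult e theta (setT :\ y) = k.+1 ->
    mult (Srel e theta) theta (setT :\ x :\ y) = (k + 2)%N.
  move=> xA yx ypos; rewrite (special_in_stable s_sym s_irr) ?inE //.
    by rewrite mult_Srel_D1 // ypos addn2.
  exact: special_in_Srel.
have posB x : x \notin A -> mult e theta (setT :\ x) = k.+1 ->
    mult e theta (~: A :\ x) = (mult e theta (~: A)).+1.
  move=> xA xpos; rewrite (mult_deleteA_D1 e_sym e_irr xA) -setTD xpos.
  by rewrite mult_deleteA // addSn.
split=> [mE|].
  have vVu : v \in setT :\ u by rewrite !inE eq_sym uv.
  have uVv : u \in setT :\ v by rewrite !inE uv.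
  have uV : u \in setT by rewrite inE.
  have vV : v \in setT by rewrite inE.
  (* Two deletions gain two and each gains at most one, so in either order the first gains exactly
     one. *)
  have upos : mult e theta (setT :\ u) = k.+1.
    rewrite -mult_Srel_D1 //; have := mult_D1_le s_sym s_irr theta vVu.
    have := mult_D1_le s_sym s_irr theta uV; rewrite mult_Srel //.
    by rewrite mE -/k; clear; lia.
  have vpos : mult e theta (setT :\ v) = k.+1.
    rewrite -mult_Srel_D1 //; have := mult_D1_le s_sym s_irr theta uVv.
    have := mult_D1_le s_sym s_irr theta vV; rewrite mult_Srel // setD1C.
    by rewrite mE -/k; clear; lia.
  have [uA|uA] := boolP (u \in A); have [vA|vA] := boolP (v \in A).
  - by constructor 1.
  - by constructor 2; left; rewrite PE vpos eqxx.
  - by constructor 2; right; rewrite PE upos eqxx.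
  have [uB vB] : u \in ~: A /\ v \in ~: A by rewrite !in_setC.
  have m0 x : x \notin A -> mult e theta (setT :\ x) = k.+1 ->
      mult e theta (Defs.comp e (~: A) x) = 0%N.
    by move=> xA xpos; apply: positive_comp_mult0; rewrite // /positive -setTD xpos.
  have uC : u \in Defs.comp e (~: A) u by rewrite inE connect0.
  have vC : v \in Defs.comp e (~: A) v by rewrite inE connect0.
  (* A common component gives (d), distinct components give (c). *)
  have [vCu|vCu] := boolP (v \in Defs.comp e (~: A) u).
    constructor 4; exists (Defs.comp e (~: A) u); split=> //.
    + exact: is_comp_comp.
    + exact: m0.
    have /(mult_delete2 e_sym e_irr uB vB uv) := mE.
    have := mult_comp_setD theta e_sym e_irr uB (sub0set _).
    rewrite !setD0 !setDDl m0 // => ->.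
    rewrite (mult_comp_setD theta e_sym e_irr uB (A := [set u; v])).
      by clear; lia.
    by rewrite subUset !sub1set uC.
  constructor 3; split; first by rewrite PE upos eqxx.
  split; first by rewrite PE vpos eqxx.
  exists (Defs.comp e (~: A) u), (Defs.comp e (~: A) v).
  split; rewrite ?m0 //; first exact: is_comp_comp; first exact: is_comp_comp.
  by split=> //; apply: contraNneq vCu => ->.
case=> [[uA vA]|[[uA vP]|[vA uP]]|[uP [vP [C1 [C2 [C1c _ C2c _ [C12 uC1 vC2]]]]]]|].
- by apply: Apos => //; [rewrite eq_sym | apply: posA].
- by apply: Apos; rewrite 1?eq_sym //; move: vP; rewrite PE => /andP[/eqP].
- by rewrite setD1C; apply: Apos => //; move: uP; rewrite PE => /andP[/eqP].
- move: uP vP; rewrite !PE => /andP[/eqP upos uA] /andP[/eqP vpos vA].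
  have [uB C1E] := comp_of_mem e_sym C1c uC1.
  have [vB C2E] := comp_of_mem e_sym C2c vC2.
  have vC1 : v \notin C1.
    apply: contra C12 => vC1.
    by have [_ ->] := comp_of_mem e_sym C1c vC1; rewrite C2E.
  apply/(mult_delete2 e_sym e_irr uB vB uv).
  (* Multiplicities add over components: deleting [u] gains one inside [C1], and deleting [v] gains
     one outside [C1]. *)
  have := posB u uA upos; have := posB v vA vpos.
  have := mult_comp_setD theta e_sym e_irr uB (sub0set _); rewrite !setD0 -C1E => ->.
  have uC1' : [set u] \subset Defs.comp e (~: A) u by rewrite -C1E sub1set.
  rewrite (mult_comp_setD theta e_sym e_irr uB uC1') -C1E.
  rewrite (mult_comp_split theta e_sym e_irr [set v] uB) -C1E.
  have -> : C1 :\ v = C1 by apply/setDidPl; rewrite disjoint_sym disjoints1.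
  rewrite (setDDl _ [set u] [set v]).
  rewrite (mult_comp_split theta e_sym e_irr [set u; v] uB) -C1E.
  have -> : C1 :\: [set u; v] = C1 :\ u.
    rewrite -setDDl; apply/setDidPl; rewrite disjoint_sym disjoints1.
    by rewrite in_setD1 (negPf vC1) andbF.
  have -> : ~: A :\: C1 :\: [set u; v] = ~: A :\: C1 :\ v.
    rewrite !setDDl setUA.
    by have /setUidPl -> : [set u] \subset C1 by rewrite sub1set.
  by rewrite -/A; clear; lia.
case=> C [Cc C0 uC vC m2].
have [uB CE] := comp_of_mem e_sym Cc uC.
have [vB _] := comp_of_mem e_sym Cc vC.
apply/(mult_delete2 e_sym e_irr uB vB uv).
(* Only the component [C] is affected, and its multiplicity rises from 0 to 2. *)
have := mult_comp_setD theta e_sym e_irr uB (sub0set _).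
rewrite !setD0 -CE C0 add0n => ->.
rewrite !setDDl (mult_comp_setD theta e_sym e_irr uB (A := [set u; v])) -?CE.
  by rewrite -setDDl m2 addnC.
by rewrite subUset !sub1set uC.
Qed.
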